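(* Let $k,d\ge2$ and $R\ge1$. For any symmetric tensor $\boldsymbol\tau\in\mathcal T(k,d)$ and any normalized rank-$R$ tensor $\boldsymbol\sigma\in\mathfrak S_R$, $$|\langle\boldsymbol\tau,\boldsymbol\sigma\rangle|\le\frac{\sqrt R}{\kappa(\boldsymbol\sigma)}\sup_{\theta\in\mathbb S^{d-1}}|\langle\boldsymbol\tau,\theta^{\otimes k}\rangle|.$$ In particular, for $\kappa\in(0,1]$, $\Gamma_{R,\kappa}\le(\sqrt R/\kappa)\,\Gamma_{1,1}$, where $$\Gamma_{R,\kappa}:=\sup\{|\langle\boldsymbol W,\boldsymbol\sigma\rangle|:\boldsymbol\sigma\in\mathfrak S_R,\ \kappa(\boldsymbol\sigma)\ge\kappa\},\qquad\Gamma_{1,1}:=\sup_{\theta\in\mathbb S^{d-1}}|\langle\boldsymbol W,\theta^{\otimes k}\rangle|.$$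
   Context: The space $\mathcal{T}(k,d)$ of real symmetric tensors of order $k$ and dimension $d$ carries the entrywise (Frobenius) inner product $\langle\cdot,\cdot\rangle$ and norm $\|\cdot\|_F$; $\langle t^{\otimes k},s^{\otimes k}\rangle=\langle t,s\rangle^k$. $\boldsymbol W$ is a standard Gaussian symmetric tensor (density proportional to $\exp(-\|\boldsymbol W\|_F^2/2)$ on $\mathcal T(k,d)$). $\mathfrak S_R$ is the set of symmetric tensors of rank at most $R$ with Frobenius norm $1$, each written as a rank-$R$ decomposition $\boldsymbol\sigma=\sum_{j=1}^Ra_jt_j^{\otimes k}$ with $a_j\ne0$, $t_j\in\mathbb S^{d-1}$ pairwise distinct. The coherence $\kappa(\boldsymbol\sigma)$, taken to lie in $(0,1]$, is defined by $\kappa^2(\boldsymbol\sigma)=\max\lambda_{\min}(\boldsymbol G)$, $G_{ij}=\langle t_i,t_j\rangle^k$, with the maximum over all rank-$R$ decompositions of $\boldsymbol\sigma$. *)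

(* Defs.v *)
From HB Require Import structures.
From mathcomp Require Import all_boot all_order all_algebra all_fingroup.
From mathcomp Require Import all_classical all_reals all_analysis.

Set Implicit Arguments.
Unset Strict Implicit.
Unset Printing Implicit Defensive.

Import Order.TTheory GRing.Theory Num.Theory.

Local Open Scope classical_set_scope.
Local Open Scope ring_scope.

Definition tensor (R : realType) (k d : nat) : Type :=
  {ffun k.-tuple 'I_d -> R}.

(* The space T(k,d) is [set T | symmetric_tensor T]. *)
Definition symmetric_tensor (R : realType) (k d : nat) (T : tensor R k d) :
    Prop :=
  forall (s : 'S_k) (i : k.-tuple 'I_d), T [tuple tnth i (s l) | l < k] = T i.

Definition tdot (R : realType) (k d : nat) (S T : tensor R k d) : R :=
  \sum_(i : k.-tuple 'I_d) S i * T i.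

Definition tnorm (R : realType) (k d : nat) (T : tensor R k d) : R :=
  Num.sqrt (tdot T T).

Definition vdot (R : realType) (d : nat) (u v : 'rV[R]_d) : R :=
  \sum_(i < d) u 0 i * v 0 i.

Definition unit_sphere (R : realType) (d : nat) : set 'rV[R]_d :=
  [set u | vdot u u = 1].
Arguments unit_sphere : clear implicits.

Definition tpow (R : realType) (k d : nat) (t : 'rV[R]_d) : tensor R k d :=
  [ffun i : k.-tuple 'I_d => \prod_(l < k) t 0 (tnth i l)].
Arguments tpow {R} k {d} t.

Definition rank_decomposition (R : realType) (k d r : nat)
    (sigma : tensor R k d) (a : 'I_r -> R) (t : 'I_r -> 'rV[R]_d) : Prop :=
  [/\ forall j, a j != 0,
      forall j, unit_sphere R d (t j),
      injective t &
      sigma = [ffun i => \sum_(j < r) a j * tpow k (t j) i]].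

(* For d >= 2 a nonzero symmetric tensor of rank at most r always has a
   decomposition with exactly r nonzero terms and pairwise distinct unit
   vectors: split a term along t and -t, and add cancelling pairs along s and
   -s.  So the last clause says that the rank is at most r. *)
Definition normalized_rank (R : realType) (k d r : nat) :
    set (tensor R k d) :=
  [set sigma | [/\ symmetric_tensor sigma, tnorm sigma = 1 &
    exists (a : 'I_r -> R) (t : 'I_r -> 'rV[R]_d),
      rank_decomposition sigma a t]].
Arguments normalized_rank : clear implicits.

Definition gram (R : realType) (k d r : nat) (t : 'I_r -> 'rV[R]_d) :
    'M[R]_r :=
  \matrix_(i, j) vdot (t i) (t j) ^+ k.

(* For a symmetric matrix of positive size the set of eigenvalues is finite
   and nonempty, so that the infimum is the least eigenvalue. *)
Definition lambda_min (R : realType) (n : nat) (G : 'M[R]_n) : R :=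
  inf [set l : R | eigenvalue G l].

(* The coherence relative to decompositions with r terms.  The supremum is the
   maximum whenever the latter exists; it is at most 1, since gram matrices
   have unit diagonal. *)
Definition kappa (R : realType) (k d r : nat) (sigma : tensor R k d) : R :=
  Num.sqrt (sup [set l : R |
    exists (a : 'I_r -> R) (t : 'I_r -> 'rV[R]_d),
      rank_decomposition sigma a t /\ l = lambda_min (gram k t)]).

Definition Gamma (R : realType) (k d r : nat) (c : R) (W : tensor R k d) : R :=
  sup [set `|tdot W sigma| | sigma in
    [set sigma | normalized_rank R k d r sigma /\ c <= kappa r sigma]].

Definition Gamma11 (R : realType) (k d : nat) (W : tensor R k d) : R :=
  sup [set `|tdot W (tpow k theta)| | theta in unit_sphere R d].

(* A symmetric tensor is determined by its entries at the nondecreasing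
   multi-indices, and these entries are free; they are linear coordinates
   identifying T(k,d) with R^N, N = size (sorted_indices k d).  All Lebesgue
   measures on T(k,d) are proportional to the one of these coordinates, which
   is therefore a valid reference measure for a density that is given up to a
   multiplicative constant. *)
Definition ord_le (d : nat) : rel 'I_d := fun x y => (x <= y)%N.
Arguments ord_le : clear implicits.

Definition sorted_indices (k d : nat) : seq (k.-tuple 'I_d) :=
  enum [pred i : k.-tuple 'I_d | sorted (ord_le d) i].

Definition ncoords (k d : nat) : nat := size (sorted_indices k d).

Definition coords (R : realType) (k d : nat) (T : tensor R k d) :
    (ncoords k d).-tuple R :=
  map_tuple T (in_tuple (sorted_indices k d)).

Definition of_coords (R : realType) (k d : nat) (x : (ncoords k d).-tuple R) :
    tensor R k d :=
  [ffun i : k.-tuple 'I_d =>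
    nth 0 x (index (sort_tuple (ord_le d) i) (sorted_indices k d))].

(* The Lebesgue integral over R^n of a nonnegative measurable function, as an
   iterated integral (Tonelli). *)
Fixpoint lebesgue_integral_tuple (R : realType) (n : nat) :
    (n.-tuple R -> \bar R) -> \bar R :=
  match n return (n.-tuple R -> \bar R) -> \bar R with
  | 0 => fun f => f [tuple]
  | m.+1 => fun f =>
      (\int[@lebesgue_measure R]_x
        lebesgue_integral_tuple (fun y : m.-tuple R => f [tuple of x :: y]))%E
  end.

(* W takes values in T(k,d) and its law has a density proportional to
   T |-> exp (- |T|_F^2 / 2). *)
Definition standard_gaussian_tensor (R : realType) (k d : nat)
    (disp : measure_display) (Omega : measurableType disp)
    (P : probability Omega R) (W : Omega -> tensor R k d) : Prop :=
  [/\ forall w, symmetric_tensor (W w),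
      measurable_fun setT (fun w => coords (W w)) &
      exists c : R, forall A : set ((ncoords k d).-tuple R), measurable A ->
        P [set w | A (coords (W w))] =
        (c%:E * lebesgue_integral_tuple (fun x : (ncoords k d).-tuple R =>
           (\1_A x * expR (- tnorm (of_coords x) ^+ 2 / 2))%:E))%E].

(* Main.v *)
(* Write sigma = sum_j a_j t_j^(x)k with Gram matrix G, and let M be the supremum
   of |<tau, theta^(x)k>| over the unit sphere.  Then
   |<tau, sigma>| <= M |a|_1 <= M sqrt(r) |a|_2, whereas
   1 = |sigma|^2 = a G a^T >= lambda_min(G) |a|_2^2.  Hence
   lambda_min(G) <tau, sigma>^2 <= r M^2 for every decomposition of sigma, and
   the supremum over decompositions replaces lambda_min(G) by kappa^2.
   That lambda_min bounds the Rayleigh quotient from below is obtained without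
   the spectral theorem: a minimizer of the quotient on the sphere, which exists
   by compactness, is an eigenvector. *)
Require Import Defs.
From HB Require Import structures.
From mathcomp Require Import all_boot all_order all_algebra all_fingroup.
From mathcomp Require Import all_classical all_reals all_analysis.
From mathcomp Require Import ring.

Set Implicit Arguments.
Unset Strict Implicit.

Import Order.TTheory GRing.Theory Num.Theory.
Import numFieldNormedType.Exports.

Local Open Scope classical_set_scope.
Local Open Scope ring_scope.

(** * The Euclidean inner product and compactness of the unit sphere *)

Lemma vdotE (R : realType) (d : nat) (u v : 'rV[R]_d) :
  vdot u v = (u *m v^T) 0 0.
Proof. by rewrite mxE; apply: eq_bigr => i _; rewrite mxE. Qed.

Lemma vdotC (R : realType) (d : nat) (u v : 'rV[R]_d) : vdot u v = vdot v u.
Proof. by apply: eq_bigr => i _; rewrite mulrC. Qed.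

Lemma vdotDl (R : realType) (d : nat) (u v w : 'rV[R]_d) :
  vdot (u + v) w = vdot u w + vdot v w.
Proof. by rewrite !vdotE mulmxDl mxE. Qed.

Lemma vdotZl (R : realType) (d : nat) (a : R) (u w : 'rV[R]_d) :
  vdot (a *: u) w = a * vdot u w.
Proof. by rewrite !vdotE -scalemxAl mxE. Qed.

Lemma vdotDr (R : realType) (d : nat) (u v w : 'rV[R]_d) :
  vdot w (u + v) = vdot w u + vdot w v.
Proof. by rewrite vdotC vdotDl !(vdotC w). Qed.

Lemma vdotZr (R : realType) (d : nat) (a : R) (u w : 'rV[R]_d) :
  vdot w (a *: u) = a * vdot w u.
Proof. by rewrite vdotC vdotZl vdotC. Qed.

Lemma vdot_ge0 (R : realType) (d : nat) (u : 'rV[R]_d) : 0 <= vdot u u.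
Proof. by apply: sumr_ge0 => i _; rewrite -expr2 sqr_ge0. Qed.

Lemma vdot_eq0 (R : realType) (d : nat) (u : 'rV[R]_d) :
  (vdot u u == 0) = (u == 0).
Proof.
rewrite /vdot psumr_eq0 => [|i _]; last by rewrite -expr2 sqr_ge0.
apply/allP/eqP => [h|-> i _]; last by rewrite mxE mul0r eqxx.
apply/rowP => i; rewrite mxE; apply/eqP.
by have := h i (mem_index_enum i); rewrite mulf_eq0 orbb.
Qed.

Lemma vdot_mulmxC (R : realType) (d : nat) (G : 'M[R]_d) (u v : 'rV[R]_d) :
  G^T = G -> vdot (u *m G) v = vdot (v *m G) u.
Proof. by move=> GT; rewrite [RHS]vdotC !vdotE trmx_mul GT mulmxA. Qed.

Lemma unit_sphere_coord (R : realType) (d : nat) (u : 'rV[R]_d) (i : 'I_d) :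
  unit_sphere R d u -> `|u 0 i| <= 1.
Proof.
rewrite /unit_sphere /= /vdot => u1.
rewrite -[leRHS]ger0_norm // -ler_sqr ?nnegrE // !real_normK ?num_real //.
rewrite expr1n -u1 (bigD1 i) //= -expr2 lerDl.
by apply: sumr_ge0 => j _; rewrite -expr2 sqr_ge0.
Qed.

Lemma unit_sphere_normalize (R : realType) (d : nat) (u : 'rV[R]_d) :
  u != 0 -> unit_sphere R d ((Num.sqrt (vdot u u))^-1 *: u).
Proof.
rewrite -vdot_eq0 => u0; rewrite /unit_sphere /= vdotZl vdotZr mulrA -expr2.
by rewrite exprVn sqr_sqrtr ?vdot_ge0 // mulVf.
Qed.

Lemma vdot_continuous (R : realType) (d : nat) (G : 'M[R]_d) :
  continuous (fun u : 'rV[R]_d => vdot (u *m G) u).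
Proof.
have mulmx_continuous i : continuous (fun u : 'rV[R]_d => (u *m G) 0 i).
  under eq_fun do rewrite mxE.
  apply: continuous_big => [|j _ u]; first exact: add_continuous.
  by apply: continuousM; [exact: coord_continuous|exact: cst_continuous].
apply: continuous_big => [|i _ u]; first exact: add_continuous.
by apply: continuousM; [exact: mulmx_continuous|exact: coord_continuous].
Qed.

(** Heine-Borel: the norm on row vectors is the largest absolute value of an entry, here at most 1,
    and the sphere is the level set at 1 of the continuous quadratic form of the identity matrix. *)
Lemma unit_sphere_compact (R : realType) (d : nat) : compact (unit_sphere R d).
Proof.
apply: bounded_closed_compact.
  exists 1; split; first exact: num_real.
  move=> M M1 u u1 /=; rewrite [leLHS]/Num.norm /= mx_normrE.
  apply/bigmax_leP; split => [|[i j] _ /=]; first by rewrite (le_trans _ (ltW M1)).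
  by rewrite ord1 (le_trans (unit_sphere_coord j u1)) // ltW.
have -> : unit_sphere R d = (fun u => vdot (u *m 1%:M) u) @^-1` [set 1].
  by apply/seteqP; split => u; rewrite /unit_sphere /= mulmx1.
by apply: preimage_closed; [move=> u _; exact: vdot_continuous|exact: closed_eq].
Qed.

(** * The Rayleigh quotient and the least eigenvalue *)

Lemma rayleigh_minimizer_eigen (R : realType) (n : nat) (G : 'M[R]_n)
    (v : 'rV[R]_n) (mu : R) :
  G^T = G -> unit_sphere R n v -> vdot (v *m G) v = mu ->
  (forall y, mu * vdot y y <= vdot (y *m G) y) -> v *m G = mu *: v.
Proof.
move=> GT v1 vmu min_mu; apply/eqP; rewrite -subr_eq0 -vdot_eq0.
set w := _ - _; set N := vdot w w.
have Nw : vdot (v *m G) w = N + mu * vdot v w.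
  by rewrite /N {2}/w vdotDl -scaleNr vdotZl mulNr subrK.
set C := vdot (w *m G) w - mu * N.
have C0 : 0 <= C by rewrite subr_ge0 min_mu.
(* The form y |-> vdot (y G) y - mu |y|^2 is nonnegative and vanishes at v, so
   its derivative at v in the direction w, which is 2 N, must be zero. *)
have h s : 0 <= 2 * s * N + s ^+ 2 * C.
  have := min_mu (v + s *: w); rewrite -subr_ge0; congr (0 <= _).
  rewrite mulmxDl -scalemxAl !vdotDl !vdotDr !vdotZl !vdotZr.
  rewrite (vdot_mulmxC w v) // (vdotC w v) vmu (v1 : vdot v v = 1).
  by rewrite Nw -/N /C; ring.
have C1 : 0 < C + 1 by rewrite ltr_wpDl.
(* The quadratic in [s] is smallest at [- N / C]; since [C] may vanish, [C + 1] replaces it. The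
   value is then a negative multiple of [N ^+ 2], which forces [N = 0]. *)
have := h (- N / (C + 1)).
have -> : 2 * (- N / (C + 1)) * N + (- N / (C + 1)) ^+ 2 * C =
    - (N ^+ 2 * ((C + 2) / (C + 1) ^+ 2)) by field; rewrite gt_eqF.
rewrite oppr_ge0 pmulr_lle0; last first.
  by rewrite divr_gt0 ?exprn_gt0 // ltr_wpDl.
by move=> N2; rewrite -sqrf_eq0 eq_le N2 sqr_ge0.
Qed.

Lemma lambda_min_rayleigh (R : realType) (n : nat) (G : 'M[R]_n)
    (x : 'rV[R]_n) :
  G^T = G -> lambda_min G * vdot x x <= vdot (x *m G) x.
Proof.
move=> GT; have [->|x0] := eqVneq x 0.
  by rewrite mul0mx !vdotE mul0mx mxE mulr0.
(* The nonzero [x], once normalized, shows that the sphere is nonempty. *)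
have [|v] := EVT_min_rV _ (@unit_sphere_compact R n)
  (continuous_subspaceT (@vdot_continuous R n G)).
  by exists ((Num.sqrt (vdot x x))^-1 *: x); exact: unit_sphere_normalize.
rewrite inE => v1 vmin; set mu := vdot (v *m G) v in vmin.
have min_mu y : mu * vdot y y <= vdot (y *m G) y.
  have [->|y0] := eqVneq y 0; first by rewrite mul0mx !vdotE mul0mx mxE mulr0.
  have := vmin _ (mem_set (unit_sphere_normalize y0)).
  rewrite -scalemxAl vdotZl vdotZr mulrA -expr2 exprVn sqr_sqrtr ?vdot_ge0 //.
  by rewrite mulrC ler_pdivlMr // lt_def vdot_eq0 y0 vdot_ge0.
apply: le_trans (min_mu x); rewrite ler_wpM2r ?vdot_ge0 // /lambda_min.
(* Two goals: [mu] bounds every eigenvalue from below, so that the infimum is a genuine one, and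
   [mu] is itself an eigenvalue. *)
apply: ge_inf => /=.
  exists mu => l /= /eigenvalueP[y yl y0].
  have := min_mu y; rewrite yl vdotZl ler_pM2r //.
  by rewrite lt_def vdot_eq0 y0 vdot_ge0.
apply/eigenvalueP; exists v; first exact: rayleigh_minimizer_eigen.
by rewrite -vdot_eq0 (v1 : vdot v v = 1) oner_eq0.
Qed.

(** * Inner products of tensors, Gram matrices and the supremum over the sphere *)

(** Distributivity expands the [k]-th power of the sum over all maps from ['I_k] to ['I_d], which
    correspond to the multi-indices. *)
Lemma tdot_tpow (R : realType) (k d : nat) (s t : 'rV[R]_d) :
  tdot (tpow k s) (tpow k t) = vdot s t ^+ k.
Proof.
rewrite -[k in RHS]card_ord -prodr_const /tdot /vdot bigA_distr_bigA /=.
rewrite (reindex (fun f : {ffun 'I_k -> 'I_d} => [tuple f l | l < k])) /=.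
  apply: eq_bigr => f _; rewrite !ffunE -big_split /=.
  by apply: eq_bigr => l _; rewrite tnth_mktuple.
exists (fun i : k.-tuple 'I_d => [ffun l => tnth i l]) => [f|i] _.
  by apply/ffunP => l; rewrite ffunE tnth_mktuple.
by apply: eq_from_tnth => l; rewrite tnth_mktuple ffunE.
Qed.

Lemma tdotC (R : realType) (k d : nat) (S T : tensor R k d) :
  tdot S T = tdot T S.
Proof. by apply: eq_bigr => i _; rewrite mulrC. Qed.

Lemma tdot_sumr (R : realType) (k d r : nat) (S : tensor R k d)
    (a : 'I_r -> R) (T : 'I_r -> tensor R k d) :
  tdot S [ffun i => \sum_j a j * T j i] = \sum_j a j * tdot S (T j).
Proof.
under [RHS]eq_bigr do rewrite mulr_sumr.
rewrite exchange_big /=; apply: eq_bigr => i _.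
by rewrite ffunE mulr_sumr; apply: eq_bigr => j _; rewrite mulrCA.
Qed.

Lemma trmx_gram (R : realType) (k d r : nat) (t : 'I_r -> 'rV[R]_d) :
  (gram k t)^T = gram k t.
Proof. by apply/matrixP => i j; rewrite !mxE vdotC. Qed.

Lemma tdot_gram (R : realType) (k d r : nat) (sigma : tensor R k d)
    (a : 'I_r -> R) (t : 'I_r -> 'rV[R]_d) :
  rank_decomposition sigma a t ->
  tdot sigma sigma = vdot ((\row_j a j) *m gram k t) (\row_j a j).
Proof.
case=> _ _ _ ->; rewrite tdot_sumr; apply: eq_bigr => i _.
rewrite tdotC tdot_sumr !mxE mulrC; congr (_ * _); apply: eq_bigr => j _.
by rewrite tdot_tpow !mxE vdotC.
Qed.

(** The entries of [tpow k theta] are products of coordinates of a unit vector, hence at most 1 in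
    absolute value. This makes [Gamma11 tau] a true upper bound. *)
Lemma tdot_tpow_ubound (R : realType) (k d : nat) (tau : tensor R k d) :
  has_ubound [set `|tdot tau (tpow k theta)| | theta in unit_sphere R d].
Proof.
exists (\sum_i `|tau i|) => _ [u u1 <-].
apply: le_trans (ler_norm_sum _ _ _) _; apply: ler_sum => i _.
rewrite normrM ffunE normr_prod ler_piMr //.
by apply: Num.Theory.prodr_ile1 => l _; rewrite normr_ge0 unit_sphere_coord.
Qed.

(** A set that is empty or unbounded above has [sup] equal to 0 by convention. *)
Lemma sup_ge0 (R : realType) (E : set R) :
  (forall x, E x -> 0 <= x) -> 0 <= sup E.
Proof.
move=> E0; have [[[x Ex] Eub]|/sup_out -> //] := pselect (has_sup E).
exact: le_trans (E0 x Ex) (ub_le_sup Eub Ex).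
Qed.

Lemma Gamma11_ge0 (R : realType) (k d : nat) (W : tensor R k d) :
  0 <= Gamma11 W.
Proof. by apply: sup_ge0 => _ [u _ <-]. Qed.

(** * From a single decomposition to the coherence *)

(** Cauchy-Schwarz against the all-ones vector, read off from the nonnegative sum of squared
    deviations from the mean [m]. The empty sum is treated apart, as [m] divides by [r]. *)
Lemma sqr_sum_le (R : realType) (r : nat) (b : 'I_r -> R) :
  (\sum_j b j) ^+ 2 <= r%:R * \sum_j b j ^+ 2.
Proof.
case: r b => [|r] b; first by rewrite !big_ord0 expr0n mul0r.
set S := \sum_j b j; set m := S / r.+1%:R.
have r0 : (r.+1%:R : R) != 0 by rewrite pnatr_eq0.
have : 0 <= \sum_j (b j - m) ^+ 2 by apply: sumr_ge0 => j _; exact: sqr_ge0.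
under eq_bigr do rewrite sqrrB.
rewrite big_split /= sumrB sumr_const card_ord sumrMnl -mulr_suml -/S.
have -> : \sum_j b j ^+ 2 - S * m *+ 2 + m ^+ 2 *+ r.+1 =
    \sum_j b j ^+ 2 - S ^+ 2 / r.+1%:R by rewrite -mulr_natr /m; field.
by rewrite subr_ge0 ler_pdivrMr ?ltr0n // mulrC.
Qed.

Lemma tdot_decomposition_le (R : realType) (k d r : nat)
    (tau sigma : tensor R k d) (a : 'I_r -> R) (t : 'I_r -> 'rV[R]_d) :
  tdot sigma sigma = 1 -> rank_decomposition sigma a t ->
  lambda_min (gram k t) * tdot tau sigma ^+ 2 <= r%:R * Gamma11 tau ^+ 2.
Proof.
(* Splitting on the sign replaces a proof that Gram matrices are positive semidefinite: a negative
   value makes the left side nonpositive. *)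
move=> sigma1 dec; have [lt0|l0] := ltP (lambda_min (gram k t)) 0.
  apply: (@le_trans _ _ 0); first by rewrite nmulr_rle0 ?sqr_ge0.
  by rewrite mulr_ge0 ?sqr_ge0.
set l := lambda_min _ in l0 *; set A := \sum_j `|a j| ^+ 2.
have lA : l * A <= 1.
  have := lambda_min_rayleigh (\row_j a j) (trmx_gram k t).
  rewrite -(tdot_gram dec) sigma1; congr (_ * _ <= _); apply: eq_bigr => j _.
  by rewrite !mxE real_normK ?num_real // expr2.
have [_ t1 _ sigmaE] := dec.
have le1 : `|tdot tau sigma| <= (\sum_j `|a j|) * Gamma11 tau.
  rewrite sigmaE tdot_sumr; apply: le_trans (ler_norm_sum _ _ _) _.
  rewrite mulr_suml; apply: ler_sum => j _; rewrite normrM ler_wpM2l //.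
  by apply: ub_le_sup; [exact: tdot_tpow_ubound|exists (t j)].
have le2 : tdot tau sigma ^+ 2 <= r%:R * A * Gamma11 tau ^+ 2.
  rewrite -real_normK ?num_real //.
  apply: (@le_trans _ _ (((\sum_j `|a j|) * Gamma11 tau) ^+ 2)).
    by rewrite ler_pXn2r ?nnegrE // (le_trans _ le1).
  by rewrite exprMn ler_wpM2r ?sqr_ge0 // sqr_sum_le.
apply: le_trans (ler_wpM2l l0 le2) _.
have -> : l * (r%:R * A * Gamma11 tau ^+ 2) =
    l * A * (r%:R * Gamma11 tau ^+ 2) by ring.
by rewrite ler_piMl // mulr_ge0 ?sqr_ge0.
Qed.

Lemma tdot_le_kappa (R : realType) (k d r : nat) (tau sigma : tensor R k d) :
  normalized_rank R k d r sigma -> 0 < kappa r sigma ->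
  `|tdot tau sigma| <= Num.sqrt r%:R / kappa r sigma * Gamma11 tau.
Proof.
case=> _ sigma1 [a [t dec]] kappa0.
have {}sigma1 : tdot sigma sigma = 1.
  rewrite -[LHS]sqr_sqrtr; last by apply: sumr_ge0 => i _; rewrite -expr2 sqr_ge0.
  by move: sigma1; rewrite /tnorm => ->; rewrite expr1n.
(* The vanishing case is separated because the bound on the supremum below divides by the square of
   this product. *)
have [->|x0] := eqVneq (tdot tau sigma) 0.
  by rewrite normr0 mulr_ge0 ?Gamma11_ge0 // divr_ge0 ?sqrtr_ge0 // ltW.
have x2 : 0 < tdot tau sigma ^+ 2 by rewrite lt_def sqrf_eq0 x0 sqr_ge0.
rewrite mulrAC ler_pdivlMr // -ler_sqr ?nnegrE; last 2 first.
- by rewrite mulr_ge0 // ltW.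
- by rewrite mulr_ge0 ?sqrtr_ge0 // Gamma11_ge0.
rewrite !exprMn real_normK ?num_real // (sqr_sqrtr (ler0n R r)) mulrC.
(* Positivity of [kappa] makes the supremum under the root positive, so squaring recovers it. *)
move: kappa0; rewrite /kappa sqrtr_gt0 => /ltW S0; rewrite (sqr_sqrtr S0).
(* After the division the right side is independent of the decomposition, so it suffices to bound
   each [lambda_min] in the set. *)
rewrite -ler_pdivlMr //; apply: ge_sup.
  by exists (lambda_min (gram k t)), a, t.
move=> _ [b [s [bs ->]]]; rewrite ler_pdivlMr //.
exact: tdot_decomposition_le bs.
Qed.

Theorem lemma9 (R : realType) (k d r : nat)
    (hk : (2 <= k)%N) (hd : (2 <= d)%N) (hr : (1 <= r)%N) :
  (forall tau sigma : tensor R k d,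
     symmetric_tensor tau -> normalized_rank R k d r sigma ->
     0 < kappa r sigma ->
     `|tdot tau sigma| <= Num.sqrt r%:R / kappa r sigma *
       sup [set `|tdot tau (tpow k theta)| | theta in unit_sphere R d])
  /\
  (forall c : R, 0 < c <= 1 ->
   forall (disp : measure_display) (Omega : measurableType disp)
     (P : probability Omega R) (W : Omega -> tensor R k d),
     standard_gaussian_tensor P W ->
     forall w : Omega,
       Gamma r c (W w) <= Num.sqrt r%:R / c * Gamma11 (W w)).
Proof.
split=> [tau sigma _|c /andP[c0 _] disp Omega P W _ w]; first exact: tdot_le_kappa.
(* If no tensor has coherence at least [c], the supremum is 0 by convention; otherwise each member
   is bounded, using that the inverse of [kappa r sigma] is at most that of [c]. *)
rewrite /Gamma; have [->|/set0P] := eqVneq [set `|tdot (W w) sigma| | sigma in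
    [set sigma | normalized_rank R k d r sigma /\ c <= kappa r sigma]] set0.
  by rewrite sup0 mulr_ge0 ?Gamma11_ge0 // divr_ge0 ?sqrtr_ge0 // ltW.
move=> ne; apply: ge_sup ne _ => _ [sigma [nsigma csigma] <-].
have kappa0 : 0 < kappa r sigma := lt_le_trans c0 csigma.
apply: le_trans (tdot_le_kappa (W w) nsigma kappa0) _.
by rewrite ler_wpM2r ?Gamma11_ge0 // ler_wpM2l ?sqrtr_ge0 // lef_pV2.
Qed.
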